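(* Let $E$ be a finite set and $e\notin E$. Let $\mathbb{B}(E)$ be the Boolean algebra of all subsets of $E$. For any modular cut $\mathcal{M}$ of $\mathbb{B}(E)$, the chain polynomial of the single-element extension $\mathbb{B}(E)+_{\mathcal{M}}e$ is real-rooted with all zeros in $[-1,0]$.
   Context: The chain polynomial of a finite poset $P$ is $c_P=\sum_{k\ge 0}c_k(P)t^k$, where $c_k(P)$ is the number of $k$-element chains of $P$. Let $L$ be a finite geometric lattice (graded, semimodular, atomistic) with rank function $\rho$. A modular cut $\mathcal{M}$ of $L$ is a (possibly empty) collection of elements of $L$ such that: (i) if $x\in\mathcal{M}$ and $y\in L$ with $x\le y$, then $y\in\mathcal{M}$; (ii) if $x,y\in\mathcal{M}$ is a modular pair, i.e. $\rho(x)+\rho(y)=\rho(x\wedge y)+\rho(x\vee y)$, then $x\wedge y\in\mathcal{M}$. Let $A$ be the set of atoms of $L$, and identify each $x\in L$ with the set $X=\{a\in A:a\le x\}$ (so $\hat 0$ corresponds to $\emptyset$); in $\mathbb{B}(E)$ the atoms are identified with the elements of $E$. For $e\notin A$, the single-element extension $L+_{\mathcal{M}}e$ is the geometric lattice, ordered by inclusion, whose elements are: (i) the sets $X\in L$ with $X\notin\mathcal{M}$; (ii) the sets $X\cup\{e\}$ with $X\in\mathcal{M}$; (iii) the sets $X\cup\{e\}$ where $X\in L$, $X\notin\mathcal{M}$, and there is no $Y\in\mathcal{M}$ with $X\subseteq Y$ and $\rho(Y)=\rho(X)+1$. *)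

(* Defs.v *)
From HB Require Import structures.
From mathcomp Require Import all_boot all_order all_algebra.
From mathcomp Require Import reals complex.

Set Implicit Arguments.
Unset Strict Implicit.
Unset Printing Implicit Defensive.

(* Orders sets by inclusion, which makes {set E} the Boolean algebra on E. *)
Export Order.DefaultSetSubsetOrder.

Import Order.TTheory GRing.Theory Num.Theory.

Local Open Scope order_scope.

Section ChainPolynomial.
Variables (d : Order.disp_t) (P : finPOrderType d).

Definition is_chain (C : {set P}) : bool :=
  [forall x in C, forall y in C, x >=< y].

Definition num_chains (k : nat) : nat :=
  #|[set C : {set P} | is_chain C & #|C| == k]|.

(* A chain of P has at most #|P| elements, so no term is cut off. *)
Definition chain_poly (R : nzRingType) : {poly R} :=
  \poly_(k < #|P|.+1) (num_chains k)%:R%R.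

End ChainPolynomial.

Section SingleElementExtension.
Variables (d : Order.disp_t) (L : finTBLatticeType d).
Implicit Types (x y a : L) (M : {set L}).

(* The length, i.e. the number of elements minus one, of a longest chain in
   the interval [\bot, x]; on a graded lattice this is the rank function. *)
Definition rank x : nat :=
  (\max_(C : {set L} | is_chain C && [forall y in C, (y <= x)%O]) #|C|)%N.-1.

Definition modular_pair x y : bool :=
  rank x + rank y == rank (x `&` y) + rank (x `|` y) :> nat.

Definition modular_cut M : Prop :=
  (forall x y, x \in M -> x <= y -> y \in M) /\
  (forall x y, x \in M -> y \in M -> modular_pair x y -> x `&` y \in M).

Definition is_atom a : bool :=
  (\bot < a) && [forall y : L, (y < a) ==> (y == \bot)].

(* The set of atoms below x, as a subset of the ground set of the extension:
   this is encoded in option L, with Some a for an atom a of L, and None for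
   the new element e, which is thus distinct from all the atoms. *)
Definition flat x : {set option L} :=
  [set Some a | a : L & is_atom a && (a <= x)].

Definition extension_flats M : {set {set option L}} :=
  [set flat x | x : L & x \notin M]
  :|: [set None |: flat x | x : L & x \in M]
  :|: [set None |: flat x | x : L &
         (x \notin M) &&
         ~~ [exists y in M, (flat x \subset flat y) && (rank y == (rank x).+1)]].

Definition extension M : Type :=
  {X : {set option L} | X \in extension_flats M}.

HB.instance Definition _ M := SubFinite.on (extension M).
HB.instance Definition _ M :=
  [SubChoice_isSubPOrder of extension M by <:
     with Order.SetSubsetOrder.subset_display].

End SingleElementExtension.

Local Open Scope ring_scope.

Definition real_rooted (R : rcfType) (p : {poly R}) : Prop :=
  forall z : R[i], root (map_poly (real_complex R) p) z ->
    exists x : R, z = real_complex R x.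

(* Main.v *)
Require Import Defs.
From mathcomp Require Import all_boot all_order all_algebra.
From mathcomp Require Import reals complex.
From mathcomp Require Import ring.

(** Two elements of a Boolean algebra always form a modular pair, so a modular
cut is empty or consists of all supersets of some set S. Adding e freely (empty
cut) gives a Boolean algebra; otherwise it gives the flats of the matroid on
E and e whose only circuit is C = S together with e. In both cases the
extension is the poset of all subsets Y of the enlarged ground set such that
C \ Y does not have exactly one element, where C is empty for the empty cut
([extension_circuit]).

For x in a poset, let h_x be the generating polynomial of the chains strictly
below x. Splitting off the maximum of a chain gives h_x = 1 + t * sum_(y < x)
h_y ([chain_gf_rec]), and the chain polynomial is (1 + t) h_1 when there is a
top. Send t^k to the function n |-> binomial(n, k). This turns a polynomial into
a function on nat that determines it ([newton_eval_inj]); the recursion says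
that h_x becomes the number of multichains of length n below x, and the operator
D : p |-> (1 + t) (t p)' becomes multiplication by n + 1 ([newton_eval_step]).
For the poset above, the multichains are counted by an explicit formula, proved
by induction on n ([newton_eval_flat]). Translating back, with w_k = D^k 1 the
polynomial h_1 of the Boolean algebra of rank k,

  chain polynomial = (1 + t) D^m (w_c - c t w_(c-1)),

where c is the size of C and m the number of elements outside C
([chain_poly_circuit]).

It remains to locate roots over the complex numbers. D preserves the property
of having all roots in [-1, 0] by the Gauss-Lucas theorem. For s = c - 1,

  w_c - c t w_s = (1 + t) t w_s' + (1 - s t) w_s,

and this is (1 + t)^(s + 2) times the derivative of t w_s / (1 + t)^(s + 1).
As w_s has degree s, the logarithmic derivative of this quotient, times 1 + t,
is again a sum of terms lam_a / (t - a) with nonnegative weights and a in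
[-1, 0], so that a weighted Gauss-Lucas argument applies
([roots_in_N10_truncation]). *)

Set Implicit Arguments.
Unset Strict Implicit.
Unset Printing Implicit Defensive.

Import Order.SetSubsetOrder.
Import Order.TTheory GRing.Theory Num.Theory.

Local Open Scope ring_scope.

(** * Polynomials with all roots in [-1, 0] *)

(** In a numClosedFieldType, [-1 <= z <= 0] forces [z] to be real. The zero
polynomial is excluded, as every point is a root of it. *)
Definition roots_in_N10 (K : numClosedFieldType) (p : {poly K}) : Prop :=
  forall z, root p z -> -1 <= z <= 0.

(** Since the inverse of w is its conjugate over [`|w| ^+ 2], the conjugate of
the equation says that z is the barycentre of the points a with the nonnegative
weights [lam a / `|z - a| ^+ 2], not all zero. *)
Lemma weighted_gauss_lucas (K : numClosedFieldType) (r : seq K) (lam : K -> K)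
    (z : K) :
  {in r, forall a, -1 <= a <= 0} -> {in r, forall a, 0 <= lam a} ->
  has (fun a => 0 < lam a) r -> {in r, forall a, z != a} ->
  \sum_(a <- r) lam a / (z - a) = 0 -> -1 <= z <= 0.
Proof.
move=> r_N10 lam_ge0 lam_gt0 z_notin sum0.
pose mu a := lam a / `|z - a| ^+ 2.
have norm_gt0 a : a \in r -> 0 < `|z - a| ^+ 2.
  by move=> ar; rewrite exprn_gt0 // normr_gt0 subr_eq0 z_notin.
have mu_ge0 a : a \in r -> 0 <= mu a.
  by move=> ar; rewrite divr_ge0 ?lam_ge0 // ltW ?norm_gt0.
have sum_mu : \sum_(a <- r) mu a * (z - a) = 0.
  suff -> : \sum_(a <- r) mu a * (z - a) = (\sum_(a <- r) lam a / (z - a))^*.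
    by rewrite sum0 conjC0.
  rewrite rmorph_sum; apply: eq_big_seq => a ar.
  rewrite /= rmorphM fmorphV /= (CrealP (ger0_real (lam_ge0 a ar))) /mu normCK.
  have za : z - a != 0 by rewrite subr_eq0 z_notin.
  by rewrite invfM -mulrA mulrAC mulVf // mul1r.
have mu_gt0 : 0 < \sum_(a <- r) mu a.
  case/hasP: lam_gt0 => b br lamb.
  rewrite (big_rem b) //= ltr_pwDl //; first by rewrite divr_gt0 ?norm_gt0.
  by rewrite big_seq sumr_ge0 // => a /mem_rem; apply: mu_ge0.
have zE : z * \sum_(a <- r) mu a = \sum_(a <- r) mu a * a.
  apply/eqP; rewrite mulr_sumr -subr_eq0 -sumrB -[X in _ == X]sum_mu.
  by apply/eqP/eq_bigr => a _; rewrite mulrBr [z * _]mulrC.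
rewrite -(ler_pM2r mu_gt0) -[z <= 0](ler_pM2r mu_gt0) zE mul0r mulN1r -sumrN.
rewrite big_seq [\sum_(a <- r) mu a * a]big_seq; apply/andP; split.
  apply: ler_sum => a ar; have /andP[a1 _] := r_N10 a ar.
  by rewrite -mulrN1 ler_wpM2l ?mu_ge0.
apply: sumr_le0 => a ar; have /andP[_ a0] := r_N10 a ar.
by rewrite mulr_ge0_le0 ?mu_ge0.
Qed.

Lemma horner_deriv_prod (K : fieldType) (r : seq K) (z : K) :
  {in r, forall a, z != a} ->
  (\prod_(a <- r) ('X - a%:P))^`().[z] =
  (\prod_(a <- r) ('X - a%:P)).[z] * \sum_(a <- r) (z - a)^-1.
Proof.
elim: r => [|b r IHr] z_notin; first by rewrite !big_nil derivC hornerC mulr0.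
have zb : z - b != 0 by rewrite subr_eq0 z_notin ?mem_head.
rewrite !big_cons derivM derivXsubC !hornerE IHr; last first.
  by move=> a ar; rewrite z_notin // in_cons ar orbT.
by rewrite mulrDr mulrAC mulfV // mul1r mulrA.
Qed.

Lemma roots_in_N10_factor (K : numClosedFieldType) (p : {poly K}) :
  roots_in_N10 p -> exists2 r : seq K,
    p = lead_coef p *: \prod_(a <- r) ('X - a%:P) &
    lead_coef p != 0 /\ {in r, forall a, -1 <= a <= 0}.
Proof.
move=> p_N10.
have lp : lead_coef p != 0.
  rewrite lead_coef_eq0; apply/eqP => p0.
  by have := p_N10 1; rewrite p0 root0 ler10 andbF => /(_ isT).
have [r rE] := closed_field_poly_normal p; exists r => //; split=> // a ar.
by apply: p_N10; rewrite rE rootZ // root_prod_XsubC.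
Qed.

(** Gauss-Lucas. The factor ['X] keeps the product nonconstant, so that its
derivative does not vanish identically. *)
Lemma roots_in_N10_derivX (K : numClosedFieldType) (p : {poly K}) :
  roots_in_N10 p -> roots_in_N10 (('X * p)^`()).
Proof.
move=> p_N10 z; have [r rE [lp r_N10]] := roots_in_N10_factor p_N10.
have r0_N10 : {in 0 :: r, forall a, -1 <= a <= 0}.
  move=> a; rewrite in_cons => /predU1P[->|/r_N10//].
  by rewrite lerN10 lexx.
have -> : 'X * p = lead_coef p *: \prod_(a <- 0 :: r) ('X - a%:P).
  by rewrite big_cons subr0 scalerAr -rE.
rewrite derivZ rootZ // => /rootP dz0.
have [zr|zr] := boolP (z \in 0 :: r); first exact: r0_N10.
have z_notin : {in 0 :: r, forall a, z != a}.
  by move=> a ar; apply: contraNneq zr => ->.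
apply: (@weighted_gauss_lucas K (0 :: r) (fun=> 1)) => //.
  by rewrite /= ltr01.
move/eqP: dz0; rewrite horner_deriv_prod // mulf_eq0 -[_ == 0]/(root _ _).
rewrite root_prod_XsubC (negPf zr) /= => /eqP sum0.
apply: etrans sum0; apply: eq_bigr => a _; exact: mul1r.
Qed.

Lemma roots_in_N10M (K : numClosedFieldType) (p q : {poly K}) :
  roots_in_N10 p -> roots_in_N10 q -> roots_in_N10 (p * q).
Proof. by move=> pu qu z; rewrite rootM => /orP[/pu|/qu]. Qed.

Lemma roots_in_N10_1DX (K : numClosedFieldType) :
  roots_in_N10 (1 + 'X : {poly K}).
Proof.
move=> z; rewrite /root !hornerE addrC addr_eq0 => /eqP->.
by rewrite lexx lerN10.
Qed.

Lemma roots_in_N10_const1 (K : numClosedFieldType) :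
  roots_in_N10 (1 : {poly K}).
Proof. by move=> z; rewrite (negPf (root1 z)). Qed.

(** Away from -1 and from the roots 0 and a_i of ['X * p], dividing the value at
z of this polynomial by [z * p.[z]] leaves the sum of [(1 + a) / (z - a)] over
a in [0 :: r], because there are s + 1 terms and each is
[(1 + z) / (z - a) - 1]. The weights [1 + a] are nonnegative, and the one of
a = 0 is positive. *)
Lemma roots_in_N10_truncation (K : numClosedFieldType) (p : {poly K}) s :
  size p = s.+1 -> roots_in_N10 p ->
  roots_in_N10 ((1 + 'X) * ('X * p^`()) + (1 - s%:R *: 'X) * p).
Proof.
move=> size_p p_N10 z; have [r rE [lp r_N10]] := roots_in_N10_factor p_N10.
have size_r : size r = s.
  by apply: succn_inj; rewrite -size_p rE size_scale // size_prod_XsubC.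
have r0_N10 : {in 0 :: r, forall a, -1 <= a <= 0}.
  move=> a; rewrite in_cons => /predU1P[->|/r_N10//].
  by rewrite lerN10 lexx.
have [zr _|zr] := boolP (z \in 0 :: r); first exact: r0_N10.
have [-> _|z1] := eqVneq z (- 1); first by rewrite lexx lerN10.
have z_notin : {in 0 :: r, forall a, z != a}.
  by move=> a ar; apply: contraNneq zr => ->.
have z0 : z != 0 by rewrite z_notin ?mem_head.
have pz : p.[z] != 0.
  apply: contra zr; rewrite -[_ == 0]/(root _ _) rE rootZ // root_prod_XsubC.
  by rewrite in_cons => ->; rewrite orbT.
have dpz : p^`().[z] = p.[z] * \sum_(a <- r) (z - a)^-1.
  rewrite [in LHS]rE derivZ hornerZ horner_deriv_prod; last first.
    by move=> a ar; rewrite z_notin // in_cons ar orbT.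
  by rewrite mulrA -hornerZ -rE.
move/rootP; rewrite !hornerE dpz => Gz0.
apply: (@weighted_gauss_lucas K (0 :: r) (fun a => 1 + a)) => //.
- by move=> a /r0_N10 /andP[a1 _]; rewrite addrC -[1]opprK subr_ge0.
- by rewrite /= addr0 ltr01.
have termE a : a \in 0 :: r -> (1 + a) / (z - a) = (1 + z) * (z - a)^-1 - 1.
  move=> /z_notin za; have za0 : z - a != 0 by rewrite subr_eq0.
  by apply: (mulIf za0); rewrite mulrBl !divfK // mul1r; ring.
rewrite (eq_big_seq _ termE) sumrB -mulr_sumr big_cons subr0.
rewrite big_const_seq count_predT iter_addr addr0 /= size_r.
apply: (mulIf z0); apply: (mulIf pz); rewrite !mul0r -[RHS]Gz0.
rewrite -[s.+1]addn1 mulrnDr mulr1n.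
by rewrite /=; field.
Qed.

(** * Polynomials as functions in the binomial basis *)

(** The linear map sending ['X^k] to n |-> ['C(n, k)]. The sum may stop at
[k = n], since the later binomial coefficients vanish. *)
Definition newton_eval (K : comNzRingType) (p : {poly K}) (n : nat) : K :=
  \sum_(k < n.+1) p`_k * 'C(n, k)%:R.

(** Applied to the generating polynomial of the chains strictly below the top of
a bounded poset P, this gives the one of the product of P with a two-element
chain; hence the name, and the role of its iterates on 1 in [boolean_poly]. *)
Definition boolean_step (K : comNzRingType) (p : {poly K}) : {poly K} :=
  (1 + 'X) * ('X * p)^`().

Lemma newton_evalD (K : comNzRingType) (p q : {poly K}) n :
  newton_eval (p + q) n = newton_eval p n + newton_eval q n.
Proof.
by rewrite -big_split; apply: eq_bigr => k _; rewrite coefD mulrDl.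
Qed.

Lemma newton_evalZ (K : comNzRingType) (a : K) (p : {poly K}) n :
  newton_eval (a *: p) n = a * newton_eval p n.
Proof. by rewrite mulr_sumr; apply: eq_bigr => k _; rewrite coefZ mulrA. Qed.

Lemma newton_evalB (K : comNzRingType) (p q : {poly K}) n :
  newton_eval (p - q) n = newton_eval p n - newton_eval q n.
Proof. by rewrite newton_evalD -scaleN1r newton_evalZ mulN1r. Qed.

Lemma newton_eval_sum (K : comNzRingType) (I : finType) (P : pred I)
    (f : I -> {poly K}) n :
  newton_eval (\sum_(i | P i) f i) n = \sum_(i | P i) newton_eval (f i) n.
Proof.
rewrite exchange_big; apply: eq_bigr => k _.
by rewrite coef_sum mulr_suml.
Qed.

Lemma newton_eval1 (K : comNzRingType) n : newton_eval (1 : {poly K}) n = 1.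
Proof.
rewrite /newton_eval big_ord_recl coef1 bin0 mulr1 big1 ?addr0 // => k _.
by rewrite coef1 mul0r.
Qed.

Lemma newton_evalXS (K : comNzRingType) (p : {poly K}) n :
  newton_eval ('X * p) n.+1 = \sum_(k < n.+1) p`_k * 'C(n.+1, k.+1)%:R.
Proof.
rewrite /newton_eval big_ord_recl coefXM mul0r add0r.
by apply: eq_bigr => k _; rewrite coefXM.
Qed.

Lemma newton_evalX0 (K : comNzRingType) (p : {poly K}) :
  newton_eval ('X * p) 0 = 0.
Proof. by rewrite /newton_eval big_ord1 coefXM mul0r. Qed.

Lemma newton_evalX (K : comNzRingType) (p : {poly K}) n :
  newton_eval ('X * p) n.+1 = newton_eval ('X * p) n + newton_eval p n.
Proof.
have -> : newton_eval ('X * p) n = \sum_(k < n.+1) p`_k * 'C(n, k.+1)%:R.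
  rewrite /newton_eval big_ord_recl coefXM mul0r add0r big_ord_recr /=.
  rewrite bin_small // mulr0 addr0.
  by apply: eq_bigr => k _; rewrite coefXM.
rewrite newton_evalXS -big_split; apply: eq_bigr => k _.
by rewrite binS natrD mulrDr.
Qed.

(** On the binomial basis this is (k + 1) binomial(n + 1, k + 1) =
(n + 1) binomial(n, k). *)
Lemma newton_eval_step (K : comNzRingType) (p : {poly K}) n :
  newton_eval (boolean_step p) n = n.+1%:R * newton_eval p n.
Proof.
rewrite /boolean_step mulrDl mul1r newton_evalD addrC.
rewrite -newton_evalX newton_evalXS mulr_sumr.
apply: eq_bigr => k _; rewrite coef_deriv coefXM /=.
rewrite -[p`_k *+ _]mulr_natr -mulrA -natrM -(mul_bin_diag n.+1) natrM.
exact: mulrCA.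
Qed.

(** The matrix of binomial coefficients is unitriangular. *)
Lemma newton_eval_inj (K : comNzRingType) (p q : {poly K}) :
  newton_eval p =1 newton_eval q -> p = q.
Proof.
move=> pq; apply/polyP; elim/ltn_ind => n IHn.
have := pq n; rewrite /newton_eval !big_ord_recr /= binn !mulr1.
suff -> : \sum_(k < n) p`_k * 'C(n, k)%:R = \sum_(k < n) q`_k * 'C(n, k)%:R.
  exact: addrI.
by apply: eq_bigr => k _; rewrite IHn.
Qed.

Definition boolean_poly (K : comNzRingType) (k : nat) : {poly K} :=
  iter k (@boolean_step K) 1.

Lemma newton_eval_iter (K : comNzRingType) (p : {poly K}) d n :
  newton_eval (iter d (@boolean_step K) p) n = n.+1%:R ^+ d * newton_eval p n.
Proof.
elim: d => [|d IHd]; first by rewrite mul1r.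
by rewrite iterS newton_eval_step IHd mulrA exprS.
Qed.

Lemma newton_eval_boolean (K : comNzRingType) k n :
  newton_eval (boolean_poly K k) n = n.+1%:R ^+ k.
Proof. by rewrite newton_eval_iter newton_eval1 mulr1. Qed.

(** The exact degree of [boolean_poly] enters [roots_in_N10_truncation]. *)
Lemma size_boolean_step (K : numDomainType) (p : {poly K}) :
  p != 0 -> size (boolean_step p) = (size p).+1.
Proof.
move=> p0; have Xp0 : 'X * p != 0 by rewrite mulf_neq0 ?polyX_eq0.
have sz : size ('X * p)^`() = size p.
  apply/eqP; rewrite eqn_leq; apply/andP; split.
    by have := lt_size_deriv Xp0; rewrite mulrC size_mulX.
  rewrite -(prednK (_ : 0 < size p)%N) ?size_poly_gt0 //.
  rewrite ltnNge; apply/negP => /leq_sizeP/(_ _ (leqnn _))/eqP.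
  by rewrite coef_deriv coefXM mulrn_eq0 /= -lead_coefE lead_coef_eq0
       (negPf p0).
have szX : size (1 + 'X : {poly K}) = 2%N.
  by rewrite addrC -[1]opprK -polyC1 -polyCN size_XsubC.
rewrite size_mul ?szX ?sz // -size_poly_eq0 ?szX ?sz //.
by rewrite size_poly_eq0.
Qed.

Lemma size_boolean_poly (K : numDomainType) k :
  size (boolean_poly K k) = k.+1.
Proof.
elim: k => [|k IHk]; first exact: size_poly1.
by rewrite size_boolean_step ?IHk // -size_poly_eq0 IHk.
Qed.

Lemma roots_in_N10_step (K : numClosedFieldType) (p : {poly K}) :
  roots_in_N10 p -> roots_in_N10 (boolean_step p).
Proof.
by move=> pu; apply: roots_in_N10M;
  [apply: roots_in_N10_1DX | apply: roots_in_N10_derivX].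
Qed.

Lemma roots_in_N10_iter_step (K : numClosedFieldType) (p : {poly K}) d :
  roots_in_N10 p -> roots_in_N10 (iter d (@boolean_step K) p).
Proof. by move=> pu; elim: d => // d IHd; apply: roots_in_N10_step. Qed.

(** The chains strictly below the top of the Boolean algebra of rank [c] that
avoid the [c] coatoms: such a chain contains at most one coatom, and the part
below it lies in a Boolean algebra of rank [c.-1]. *)
Definition circuit_poly (K : comNzRingType) (c : nat) : {poly K} :=
  boolean_poly K c - c%:R *: ('X * boolean_poly K c.-1).

Lemma roots_in_N10_circuit (K : numClosedFieldType) c :
  roots_in_N10 (circuit_poly K c).
Proof.
case: c => [|s].
  by rewrite /circuit_poly scale0r subr0; apply: roots_in_N10_const1.
have := roots_in_N10_truncation (size_boolean_poly K s)
  (@roots_in_N10_iter_step K 1 s (@roots_in_N10_const1 K)).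
suff -> : (1 + 'X) * ('X * (boolean_poly K s)^`()) +
    (1 - s%:R *: 'X) * boolean_poly K s = circuit_poly K s.+1 by [].
rewrite /circuit_poly /= -/(boolean_poly K s) /boolean_step derivM derivX.
by rewrite -!mul_polyC !polyC_natr; ring.
Qed.

(** * Generating polynomials of chains *)

Lemma is_chain_subset d (P : finPOrderType d) (C D : {set P}) :
  C \subset D -> is_chain D -> is_chain C.
Proof.
move=> /subsetP CD /forall_inP chD; apply/forall_inP => x xC.
apply/forall_inP => y yC.
by have /forall_inP := chD x (CD x xC); apply; apply: CD.
Qed.

(** The maximum is the element of the chain with most elements of the chain
below it. *)
Lemma chain_max d (P : finPOrderType d) (C : {set P}) :
  is_chain C -> C != set0 ->
  exists2 y, y \in C & forall z, z \in C -> (z <= y)%O.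
Proof.
move=> /forall_inP chC /set0Pn[x0 x0C].
pose below x := [set z in C | (z <= x)%O].
have [y yC ymax] : exists2 y, y \in C & forall z,
    z \in C -> (#|below z| <= #|below y|)%N.
  by case: (@arg_maxnP _ x0 (mem C) (fun x => #|below x|) x0C) => y; exists y.
exists y => // z zC; have /forall_inP/(_ z zC)/orP[yz|//] := chC y yC.
have [->|zy] := eqVneq z y; first by [].
have /proper_card : below y \proper below z.
  apply/properP; split.
    by apply/subsetP => t; rewrite !inE => /andP[-> /le_trans]; apply.
  exists z; first by rewrite inE zC /=.
  rewrite inE zC /=.
  by apply: contra zy => zy; rewrite eq_le zy.
by rewrite ltnNge ymax.
Qed.

Definition chain_gf (K : comNzRingType) d (P : finPOrderType d) (D : {set P}) :
    {poly K} :=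
  \sum_(C : {set P} | is_chain C && (C \subset D)) 'X^#|C|.

Lemma chain_polyE (K : comNzRingType) d (P : finPOrderType d) :
  chain_poly P K = chain_gf K [set: P].
Proof.
apply/polyP => k; rewrite coef_poly coef_sum.
have -> : \sum_(C : {set P} | is_chain C && (C \subset [set: P]))
    ('X^#|C| : {poly K})`_k = (num_chains P k)%:R.
  rewrite /num_chains -sum1_card natr_sum big_mkcond [RHS]big_mkcond /=.
  apply: eq_bigr => C _; rewrite subsetT andbT inE coefXn eq_sym.
  by case: is_chain; case: (_ == _).
case: ltnP => // kP; rewrite /num_chains (_ : [set _ | _] = set0) ?cards0 //.
apply/setP => C; rewrite !inE; apply: contraTF kP => /andP[_ /eqP <-].
by rewrite -ltnNge ltnS max_card.
Qed.

(** A nonempty chain in a down-set is its maximum [y] together with a chain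
strictly below [y], which may be any such chain. *)
Lemma chain_gf_rec (K : comNzRingType) d (P : finPOrderType d) (D : {set P}) :
  (forall x y, y \in D -> (x <= y)%O -> x \in D) ->
  chain_gf K D = 1 + 'X * \sum_(y in D) chain_gf K [set x | (x < y)%O].
Proof.
move=> downD; pose is_top y (C : {set P}) :=
  (y \in C) && [forall z in C, (z <= y)%O].
have chain0 : is_chain (set0 : {set P}) && (set0 \subset D).
  by rewrite sub0set andbT; apply/forall_inP => x; rewrite inE.
rewrite /chain_gf (bigD1 (set0 : {set P}) chain0) /= cards0 expr0.
congr (1 + _).
transitivity (\sum_(C : {set P} | is_chain C && (C \subset D) && (C != set0))
    \sum_(y | is_top y C) ('X^#|C| : {poly K})).
  apply: eq_bigr => C /andP[/andP[chC CD] C0].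
  have [y yC ymax] := chain_max chC C0.
  rewrite (big_pred1 y) // => z; apply/andP/eqP => [[zC /forall_inP zmax]|->].
    by apply/le_anti; rewrite ymax ?zmax.
  by split=> //; apply/forall_inP.
rewrite (exchange_big_dep (mem D)) /=; last first.
  by move=> C y /andP[/andP[_ /subsetP CD] _] /andP[/CD].
rewrite mulr_sumr; apply: eq_bigr => y yD.
(* The chains with maximum y correspond to the chains strictly below y. *)
rewrite (reindex_onto (fun C => y |: C) (fun C => C :\ y)) /=; last first.
  by move=> C /andP[_ /andP[yC _]]; rewrite setD1K.
rewrite mulr_sumr; apply: eq_big => [C|C /andP[_ /eqP yC]]; last first.
  rewrite cardsU1 exprD (_ : y \in C = false) ?expr1 //.
  by rewrite -yC !inE eqxx.
apply/idP/idP.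
  move=> /andP[/andP[/andP[/andP[chC _] _]]] /andP[_ /forall_inP ymax] /eqP yC.
  rewrite (is_chain_subset (subsetU1 y C) chC).
  apply/subsetP => z zC; rewrite inE lt_def ymax ?in_setU1 ?zC ?orbT // andbT.
  by apply: contraTneq zC => <-; rewrite -yC !inE eqxx.
move=> /andP[/forall_inP chC /subsetP Cy].
have yC : y \notin C by apply/negP => /Cy; rewrite inE ltxx.
rewrite setU1K // eqxx andbT; apply/andP; split; last first.
  rewrite /is_top setU11; apply/forall_inP => z; rewrite in_setU1.
  by case/predU1P => [->//|/Cy]; rewrite inE => /ltW.
apply/andP; split; last by apply/set0Pn; exists y; rewrite setU11.
apply/andP; split; last first.
  apply/subsetP => z; rewrite in_setU1 => /predU1P[->//|/Cy].
  by rewrite inE => /ltW; apply: downD.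
apply/forall_inP => u; rewrite in_setU1 => uy.
apply/forall_inP => v; rewrite in_setU1 => vy.
case/predU1P: uy => [->|uC]; case/predU1P: vy => [->|vC].
- by rewrite /Order.comparable lexx.
- by have := Cy _ vC; rewrite inE => /ltW vy; rewrite /Order.comparable vy orbT.
- by have := Cy _ uC; rewrite inE => /ltW uy; rewrite /Order.comparable uy.
- by have /forall_inP := chC u uC; apply.
Qed.

(** * The subsets that do not miss exactly one element of a circuit *)

(** Expand the product over i of [1 + q] for i in [B :\: A] and of 1
elsewhere, each factor written as [f i + g i] where f vanishes outside B and g
vanishes on A: only the Z in the interval contribute. *)
Lemma sum_interval (K : comNzRingType) (F : finType) (A B : {set F}) (q : K) :
  A \subset B ->
  \sum_(Z : {set F} | (A \subset Z) && (Z \subset B)) q ^+ #|Z :\: A| =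
  (1 + q) ^+ #|B :\: A|.
Proof.
move=> /subsetP AB.
pose f i := if i \in A then 1 else if i \in B then q else 0.
pose g i : K := if i \in A then 0 else 1.
transitivity (\sum_(Z : {set F}) \prod_i (if i \in Z then f i else g i)).
  rewrite big_mkcond; apply: eq_bigr => Z _.
  case: ifP => [/andP[/subsetP AZ /subsetP ZB]|].
    rewrite -prodr_const big_mkcond; apply: eq_bigr => i _; rewrite /f /g inE.
    case: (boolP (i \in A)) => [/AZ -> //|iA] /=.
    by case: (boolP (i \in Z)) => [/ZB -> //|].
  move/negbT; rewrite negb_and => /orP[] /subsetPn[i iA iZ].
    by rewrite (bigD1 i) //= (negPf iZ) /g iA mul0r.
  rewrite (bigD1 i) //= iA /f (negPf iZ) ifN ?mul0r //.
  by apply: contra iZ => /AB.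
rewrite -bigA_distr -prodr_const [RHS]big_mkcond; apply: eq_bigr => i _.
rewrite /f /g inE; case: (boolP (i \in A)) => _ /=; first by rewrite addr0.
by case: (i \in B); rewrite ?add0r // addrC.
Qed.

(** If Z misses only a from C and lies in Y, then Y misses at most a from C,
hence nothing, as it does not miss exactly one element. For each a in C these Z
form the interval from [C :\ a] to [Y :\ a]. *)
Lemma sum_circuit_hyperplanes (K : comNzRingType) (F : finType)
    (C Y : {set F}) (q : K) :
  #|C :\: Y| != 1%N ->
  \sum_(Z : {set F} | (Z \subset Y) && (#|C :\: Z| == 1%N)) q ^+ #|Z| =
  (C \subset Y)%:R * (1 + q) ^+ #|Y :\: C| * (#|C|%:R * q ^+ #|C|.-1).
Proof.
move=> CY1; have [CY|CY] := boolP (C \subset Y); last first.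
  rewrite !mul0r big1 // => Z /andP[ZY /eqP CZ1].
  have := subset_leq_card (setDS C ZY); rewrite CZ1 leq_eqVlt (negPf CY1) /=.
  by rewrite ltnS leqn0 cards_eq0 setD_eq0 (negPf CY).
transitivity (\sum_(Z : {set F} | (Z \subset Y) && (#|C :\: Z| == 1%N))
    \sum_(a | C :\: Z == [set a]) q ^+ #|Z|).
  apply: eq_bigr => Z /andP[_ /cards1P[a CZ]]; rewrite CZ (big_pred1 a) // => b.
  by rewrite (inj_eq set1_inj) eq_sym.
rewrite (exchange_big_dep (mem C)) /=; last first.
  by move=> Z a _ /eqP CZ; have := set11 a; rewrite -CZ inE => /andP[].
transitivity (\sum_(a in C) q ^+ #|C|.-1 * (1 + q) ^+ #|Y :\: C|); last first.
  by rewrite sumr_const mul1r -mulr_natl; ring.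
apply: eq_bigr => a aC; have aY := subsetP CY a aC.
have cardC : #|C :\ a| = #|C|.-1 by rewrite (cardsD1 a C) aC.
have -> : Y :\: C = (Y :\ a) :\: (C :\ a).
  by apply/setP => b; rewrite !inE; case: eqP => //= ->; rewrite aC.
rewrite -sum_interval ?setSD // mulr_sumr.
apply: eq_big => [Z|Z /andP[/andP[_ _] /eqP CZ]]; last first.
  have sub : C :\ a \subset Z.
    apply/subsetP => b; rewrite !inE => /andP[ba bC]; apply: contraNT ba => bZ.
    by have := set11 b; rewrite -in_set1 -CZ !inE bC bZ.
  by rewrite -cardC -exprD -(cardsID (C :\ a) Z) (setIidPr sub).
apply/idP/idP.
  move=> /andP[/andP[/subsetP ZY _] /eqP CZ]; apply/andP; split.
    apply/subsetP => b; rewrite !inE => /andP[ba bC]; apply: contraNT ba => bZ.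
    by rewrite -in_set1 -CZ !inE bC bZ.
  apply/subsetP => b bZ; rewrite !inE ZY // andbT; apply: contraTneq bZ => ->.
  by have := set11 a; rewrite -CZ inE => /andP[].
move=> /andP[/subsetP CZ /subsetP ZY].
have CZa : C :\: Z = [set a].
  apply/setP => b; rewrite !inE; have [->|ba] := eqVneq b a.
    by rewrite aC andbT; apply/negP => /ZY; rewrite !inE eqxx.
  by apply/negP => /andP[bZ bC]; move: bZ; rewrite CZ // !inE ba.
rewrite CZa cards1 !eqxx !andbT; apply/subsetP => b /ZY.
by rewrite !inE => /andP[].
Qed.

(** The poset enters the counting only through an order embedding [phi] onto
the subsets that do not miss exactly one element of C. *)
Lemma sum_flats (K : comNzRingType) d (P : finPOrderType d) (F : finType)
    (C : {set F}) (phi : P -> {set F}) (x : P) (f : {set F} -> K) :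
  (forall x y, (x <= y)%O = (phi x \subset phi y)) ->
  (forall Y, (Y \in codom phi) = (#|C :\: Y| != 1%N)) ->
  \sum_(y | (y <= x)%O) f (phi y) =
  \sum_(Z : {set F} | (Z \subset phi x) && (#|C :\: Z| != 1%N)) f Z.
Proof.
move=> le_phi im_phi.
have phi_inj : injective phi.
  by move=> y z yz; apply/le_anti; rewrite !le_phi yz subxx.
transitivity (\sum_(y in [set y | (y <= x)%O]) f (phi y)).
  by apply: eq_bigl => y; rewrite inE.
rewrite -(big_imset f (in2W phi_inj)); apply: eq_bigl => Z.
apply/imsetP/andP => [[y]|[Zx]].
  by rewrite inE le_phi => yx ->; rewrite -im_phi codom_f.
by rewrite -im_phi => /codomP[y Zy]; exists y; rewrite // inE le_phi -Zy.
Qed.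

(** Below an element that does not contain C the poset is Boolean, which gives
the first term. The correction for elements above C collects, as n grows, the
contributions of the sets that miss exactly one element of C. The formula
has the same shape for all elements, so one induction on n covers both kinds. *)
Lemma newton_eval_flat (K : comNzRingType) d (P : finPOrderType d) (F : finType)
    (C : {set F}) (phi : P -> {set F}) (x : P) n :
  (forall x y, (x <= y)%O = (phi x \subset phi y)) ->
  (forall Y, (Y \in codom phi) = (#|C :\: Y| != 1%N)) ->
  newton_eval (chain_gf K [set y | (y < x)%O]) n =
  n.+1%:R ^+ #|phi x| - (C \subset phi x)%:R * n.+1%:R ^+ #|phi x :\: C| *
    (#|C|%:R * newton_eval ('X * boolean_poly K #|C|.-1) n).
Proof.
move=> le_phi im_phi.
have recE y : chain_gf K [set z | (z < y)%O] =
    1 + 'X * \sum_(z | (z < y)%O) chain_gf K [set t | (t < z)%O].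
  rewrite chain_gf_rec => [|z t]; last first.
    by rewrite !inE => ty zt; apply: le_lt_trans zt ty.
  by congr (1 + 'X * _); apply: eq_bigl => z; rewrite inE.
elim: n x => [|n IHn] x.
  rewrite recE newton_evalD newton_eval1 !newton_evalX0 mulr0 mulr0.
  by rewrite expr1n subr0 addr0.
(* A multichain of length n + 1 below x is its last element y followed by a
   multichain of length n below y. *)
have -> : newton_eval (chain_gf K [set y | (y < x)%O]) n.+1 =
    \sum_(y | (y <= x)%O) newton_eval (chain_gf K [set z | (z < y)%O]) n.
  rewrite (bigD1 x) //= recE newton_evalD newton_eval1 newton_evalX addrA.
  rewrite newton_evalD newton_eval1; congr (_ + _).
  rewrite newton_eval_sum; apply: eq_bigl => y.
  by rewrite lt_neqAle andbC.
under eq_bigr => y _ do rewrite IHn.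
set q := n.+1%:R; set c := #|C|%:R * newton_eval _ n.
rewrite (sum_flats x
  (fun Z => q ^+ #|Z| - (C \subset Z)%:R * q ^+ #|Z :\: C| * c) le_phi im_phi).
have CY1 : #|C :\: phi x| != 1%N by rewrite -im_phi codom_f.
have q1 : n.+2%:R = 1 + q :> K by rewrite -natr1 addrC.
rewrite sumrB newton_evalX newton_eval_boolean -/q q1 mulrDr mulrDr.
rewrite opprD [- _ - _]addrC addrA; congr (_ + _).
  have <- : \sum_(Z : {set F} | Z \subset phi x) q ^+ #|Z| =
      (1 + q) ^+ #|phi x|.
    rewrite -[in RHS](setD0 (phi x)) -sum_interval ?sub0set //.
    by apply: eq_big => [Z|Z _]; rewrite ?sub0set ?setD0.
  rewrite [X in _ = X - _](bigID (fun Z : {set F} => #|C :\: Z| == 1%N)) /=.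
  rewrite (sum_circuit_hyperplanes q CY1).
  by rewrite addrAC subrr add0r.
rewrite -mulr_suml; congr (- (_ * _)).
have [CY|CY] := boolP (C \subset phi x); last first.
  rewrite mul0r big1 // => Z /andP[ZY _]; case: (boolP (C \subset Z)) => [CZ|].
    by rewrite (subset_trans CZ ZY) in CY.
  by rewrite mul0r.
rewrite mul1r -(sum_interval q CY) big_mkcond [RHS]big_mkcond.
apply: eq_bigr => Z _; case: (boolP (C \subset Z)) => [CZ|CZ] /=; last first.
  by rewrite mul0r if_same.
have -> : C :\: Z = set0 by apply/eqP; rewrite setD_eq0.
by rewrite cards0 andbT mul1r.
Qed.

(** The factor [1 + 'X] accounts for the top element, which may be added to or
removed from any chain. *)
Lemma chain_poly_circuit (K : comNzRingType) d (P : finPOrderType d)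
    (F : finType) (C : {set F}) (phi : P -> {set F}) :
  (forall x y, (x <= y)%O = (phi x \subset phi y)) ->
  (forall Y, (Y \in codom phi) = (#|C :\: Y| != 1%N)) ->
  chain_poly P K =
  (1 + 'X) * iter #|~: C| (@boolean_step K) (circuit_poly K #|C|).
Proof.
move=> le_phi im_phi.
have /codomP[x xT] : [set: F] \in codom phi by rewrite im_phi setDT cards0.
have x_max y : (y <= x)%O by rewrite le_phi -xT subsetT.
have -> : iter #|~: C| (@boolean_step K) (circuit_poly K #|C|) =
    chain_gf K [set y | (y < x)%O].
  apply: newton_eval_inj => n.
  rewrite newton_eval_iter (newton_eval_flat _ _ _ le_phi im_phi) -xT subsetT.
  rewrite newton_evalB newton_evalZ newton_eval_boolean mul1r setTD.
  by rewrite mulrBr -exprD addnC cardsC cardsT.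
rewrite chain_polyE chain_gf_rec => [|y z]; last by rewrite !inE.
rewrite (bigD1 x) ?inE //= mulrDr addrCA mulrDl mul1r addrC; congr (_ + _).
rewrite [RHS]chain_gf_rec => [|y z]; last first.
  by rewrite !inE => ty zt; apply: le_lt_trans zt ty.
congr (1 + 'X * _); apply: eq_bigl => y.
by rewrite !inE lt_neqAle x_max andbT.
Qed.

(** * Single-element extensions of a Boolean algebra *)

(** Along a chain of subsets of X the cardinality is injective with values at
most [#|X|]; the prefixes of an enumeration of X attain this bound. *)
Lemma rank_card (E : finType) (X : {set E}) : rank X = #|X|.
Proof.
rewrite /rank; set m := (X in X.-1); suff -> : m = #|X|.+1 by [].
apply/eqP; rewrite eqn_leq; apply/andP; split.
  apply/bigmax_leqP => C /andP[/forall_inP chC /forall_inP CX].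
  pose f (Z : {set E}) : 'I_#|X|.+1 := inord #|Z|.
  have f_inj : {in C &, injective f}.
    move=> Y Z YC ZC /(congr1 val).
    have bound W : W \in C -> (#|W| < #|X|.+1)%N.
      by move=> /CX; rewrite leEsubset ltnS; apply: subset_leq_card.
    rewrite /= !inordK ?bound // => cardYZ.
    have /forall_inP/(_ Z ZC)/orP[] := chC Y YC; rewrite leEsubset => YZ.
      by apply/eqP; rewrite eqEcard YZ cardYZ /=.
    by apply/esym/eqP; rewrite eqEcard YZ cardYZ /=.
  by rewrite -(card_in_imset f_inj) -[X in (_ <= X)%N]card_ord max_card.
pose prefix_set (i : 'I_#|X|.+1) := [set x in take i (enum X)].
have card_prefix i : #|prefix_set i| = i.
  rewrite cardsE (card_uniqP (take_uniq _ (enum_uniq _))) size_take -cardE.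
  by case: ltnP => // Xi; apply/eqP; rewrite eqn_leq Xi -ltnS ltn_ord.
have prefix_le (i j : 'I_#|X|.+1) : (i <= j)%N ->
    prefix_set i \subset prefix_set j.
  move=> ij; apply/subsetP => x; rewrite !inE -(subnKC ij) takeD mem_cat.
  by move=> ->.
rewrite -[X in (X <= _)%N]card_ord -(card_imset (f := prefix_set)) => [|i j ij].
  apply: leq_bigmax_cond; apply/andP; split.
    apply/forall_inP => _ /imsetP[i _ ->].
    apply/forall_inP => _ /imsetP[j _ ->].
    rewrite /Order.comparable !leEsubset.
    by case/orP: (leq_total i j) => /prefix_le ->; rewrite ?orbT.
  apply/forall_inP => _ /imsetP[i _ ->]; rewrite leEsubset.
  by apply/subsetP => x; rewrite inE => /mem_take; rewrite mem_enum.
by apply: val_inj; rewrite /= -card_prefix ij card_prefix.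
Qed.

(** Every pair is modular, so M is closed under intersections and its member of
least cardinality lies below all the others. *)
Lemma modular_cut_principal (E : finType) (M : {set {set E}}) :
  modular_cut M -> M != set0 ->
  exists S : {set E}, forall X, (X \in M) = (S \subset X).
Proof.
move=> [upM meetM] /set0Pn[X0 X0M].
case: (@arg_minnP _ X0 (mem M) (fun X => #|X|) X0M) => S SM Smin.
exists S => X; apply/idP/idP => [XM|SX]; last first.
  by apply: upM SM _; rewrite leEsubset.
have SIX : S :&: X \in M.
  apply: meetM => //; rewrite /modular_pair !rank_card meetEsubset joinEsubset.
  by rewrite [in eqbRHS]addnC cardsUI.
have /eqP <- : S :&: X == S by rewrite eqEcard subsetIl Smin.
exact: subsetIr.
Qed.

Lemma is_atomE (E : finType) (a : {set E}) :
  reflect (exists x, a = [set x]) (is_atom a).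
Proof.
rewrite /is_atom; apply: (iffP andP) => [[a0 /forallP a_min]|[x ->]].
  have /set0Pn[x xa] : a != set0 by move: a0; rewrite lt0x.
  exists x; have := a_min [set x]; rewrite lt_neqAle leEsubset sub1set xa andbT.
  case: eqVneq => [//|_ /=]; rewrite botEsubset => /eqP x0.
  by have := set11 x; rewrite x0 inE.
split; first by rewrite lt0x botEsubset -card_gt0 cards1.
apply/forallP => y; apply/implyP.
rewrite lt_neqAle leEsubset subset1 => /andP[/negPf ->] /=.
by rewrite botEsubset.
Qed.

Lemma flatE (E : finType) (X : {set E}) :
  flat X = [set omap set1 o | o in Some @: X].
Proof.
apply/setP => o; apply/imsetP/imsetP => [[a]|[_ /imsetP[x xX ->] ->]].
  rewrite inE => /andP[/is_atomE[x ->]]; rewrite leEsubset sub1set => xX ->.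
  by exists (Some x) => //; apply: imset_f.
exists [set x] => //; rewrite inE leEsubset sub1set xX andbT.
by apply/is_atomE; exists x.
Qed.

Lemma omap_set1_inj (E : finType) : injective (omap (@set1 E)).
Proof. by move=> [x|] [y|] //= [] /set1_inj ->. Qed.

(** The atoms of the Boolean algebra are singletons, so a set of atoms and of
the new point comes from a subset of [option E] along [omap set1]. If S
generates the cut, C consists of S and the new point: a set X without the new
point misses [#|S :\: X|.+1] elements of C, a set with it misses
[#|S :\: X|], and an X outside the cut is covered by a member of it exactly when
this last number is 1. For an empty cut, the empty set C excludes nothing. *)
Lemma extension_flats_circuit (E : finType) (M : {set {set E}}) :
  modular_cut M ->
  exists C : {set option E}, forall Z : {set option {set E}},
    (Z \in extension_flats M) =
    [exists Y : {set option E},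
      (#|C :\: Y| != 1%N) && (Z == [set omap set1 o | o in Y])].
Proof.
move=> cutM.
have [C okC] : exists C : {set option E},
    (forall X : {set E}, (#|C :\: Some @: X| != 1%N) = (X \notin M)) /\
    (forall X : {set E}, (#|C :\: (None |: Some @: X)| != 1%N) =
       (X \in M) || ~~ [exists y in M, (flat X \subset flat y) &&
                          (rank y == (rank X).+1)]).
  have [->|M0] := eqVneq M set0.
    exists set0; split=> X; rewrite set0D cards0 inE //=.
    by apply/esym/existsP => -[y]; rewrite inE.
  have [S MS] := modular_cut_principal cutM M0.
  exists (None |: Some @: S).
  have Some_inj : injective (@Some E) by move=> x y [].
  have imD (X : {set E}) : Some @: S :\: Some @: X = Some @: (S :\: X).
    apply/setP => -[x|].
      by rewrite inE !(mem_imset _ _ Some_inj) inE.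
    by rewrite inE; apply/andP/imsetP => [[_ /imsetP[]]|[]].
  have NoneX (X : {set E}) : (None : option E) \notin Some @: X.
    by apply/imsetP => -[].
  split=> X.
    have -> : (None |: Some @: S) :\: Some @: X = None |: Some @: (S :\: X).
      rewrite setDUl imD; congr (_ :|: _); apply/setP => o; rewrite !inE andbC.
      by case: eqP => // ->; rewrite NoneX.
    by rewrite cardsU1 NoneX card_imset // MS eqSS cards_eq0 setD_eq0.
  have -> : (None |: Some @: S) :\: (None |: Some @: X) = Some @: (S :\: X).
    rewrite setDUl -imD; apply/setP => -[x|]; rewrite !inE /= ?andbF //.
    by rewrite (negPf (NoneX S)) andbF.
  rewrite card_imset // MS.
  have flatS Y : (flat X \subset flat Y) = (X \subset Y).
    rewrite !flatE; apply/subsetP/subsetP => [XY x xX|XY o].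
      have /XY := imset_f (omap set1) (imset_f Some xX).
      by rewrite (mem_imset _ _ (@omap_set1_inj E)) (mem_imset _ _ Some_inj).
    case/imsetP => _ /imsetP[x xX ->] ->; apply: imset_f; apply: imset_f.
    exact: XY.
  case: (boolP (S \subset X)) => SX /=.
    by move: SX; rewrite -setD_eq0 => /eqP ->; rewrite cards0.
  congr (~~ _); apply/eqP/existsP => [SX1|[Y]].
    exists (X :|: S); rewrite MS subsetUr flatS subsetUl !rank_card /=.
    by rewrite cardsU -(cardsID X S) SX1 [S :&: X]setIC addnCA addKn addn1.
  rewrite MS flatS !rank_card => /and3P[SY XY /eqP cardY].
  have : (#|S :\: X| <= #|Y :\: X|)%N by apply/subset_leq_card/setSD.
  rewrite [#|Y :\: X|]cardsD (setIidPr XY) cardY subSnn leq_eqVlt ltnS.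
  rewrite leqn0 cards_eq0.
  by rewrite setD_eq0 (negPf SX) orbF => /eqP.
case: okC => okX okeX.
exists C => Z; apply/idP/existsP => [|[Y /andP[okY /eqP ->]]].
  have lift_None (X : {set E}) :
      None |: flat X = [set omap set1 o | o in None |: Some @: X].
    by rewrite imsetU1 flatE.
  rewrite !inE => /orP[/orP[]|] /imsetP[X]; rewrite inE => XM ->.
  - by exists (Some @: X); rewrite okX XM flatE /=.
  - by exists (None |: Some @: X); rewrite okeX XM lift_None /=.
  - case/andP: XM => XM noY.
    by exists (None |: Some @: X); rewrite okeX noY orbT lift_None /=.
pose X := [set x | Some x \in Y].
have SomeX x : (Some x \in Some @: X) = (Some x \in Y).
  by rewrite mem_imset ?inE // => u v [].
have [NY|NY] := boolP (None \in Y).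
  have YE : Y = None |: Some @: X.
    by apply/setP => -[x|]; rewrite !inE ?SomeX.
  rewrite {}YE okeX in okY *; rewrite imsetU1 -flatE !inE.
  have [XM|XM] := boolP (X \in M).
    by rewrite (imset_f (fun X => None |: flat X)) ?orbT // inE.
  rewrite (negPf XM) /= in okY.
  apply/orP; right; apply: (imset_f (fun X => None |: flat X)).
  by rewrite inE XM.
have YE : Y = Some @: X.
  apply/setP => -[x|]; first by rewrite SomeX.
  by rewrite (negPf NY); apply/esym/imsetP => -[].
rewrite {}YE okX in okY *; rewrite -flatE !inE.
by rewrite (imset_f (fun X => flat X)) // inE.
Qed.

Lemma extension_circuit (E : finType) (M : {set {set E}}) :
  modular_cut M ->
  exists (C : {set option E}) (phi : extension M -> {set option E}),
    (forall x y, (x <= y)%O = (phi x \subset phi y)) /\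
    (forall Y, (Y \in codom phi) = (#|C :\: Y| != 1%N)).
Proof.
move=> /extension_flats_circuit[C flatsC].
pose phi (x : extension M) : {set option E} := omap set1 @^-1: val x.
have phiK x : [set omap set1 o | o in phi x] = val x.
  have := valP x; rewrite flatsC => /existsP[Y /andP[_ /eqP xY]].
  suff -> : phi x = Y by [].
  by apply/setP => o; rewrite inE xY (mem_imset _ _ (@omap_set1_inj E)).
exists C, phi; split=> [x y|Y].
  rewrite leEsub leEsubset; apply/idP/idP => [|xy]; first exact: preimsetS.
  by rewrite -(phiK x) -(phiK y) imsetS.
apply/codomP/idP => [[x ->]|okY].
  have := valP x; rewrite flatsC => /existsP[Y' /andP[okY' /eqP xY']].
  suff -> : phi x = Y' by [].
  by apply: (imset_inj (@omap_set1_inj E)); rewrite phiK xY'.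
have flatY : [set omap set1 o | o in Y] \in extension_flats M.
  by rewrite flatsC; apply/existsP; exists Y; rewrite okY /=.
exists (exist (fun X => X \in extension_flats M) _ flatY : extension M).
by apply: (imset_inj (@omap_set1_inj E)); rewrite phiK.
Qed.

Theorem corollary6p9 (R : realType) (E : finType) (M : {set {set E}})
    (hM : modular_cut M) :
  let c := chain_poly (extension M) R in
  real_rooted c /\ (forall x : R, root c x -> -1 <= x <= 0).
Proof.
move=> c; pose toC := real_complex R.
have mapc : map_poly toC c = chain_poly (extension M) R[i].
  apply/polyP => k; rewrite coef_map !coef_poly.
  by case: ifP => _; [exact: (rmorph_nat toC) | exact: (rmorph0 toC)].
have c_N10 : roots_in_N10 (map_poly toC c).
  have [C [phi [le_phi im_phi]]] := extension_circuit hM.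
  rewrite mapc (chain_poly_circuit _ le_phi im_phi).
  apply: roots_in_N10M; first exact: roots_in_N10_1DX.
  by apply: roots_in_N10_iter_step; apply: roots_in_N10_circuit.
split=> [z /c_N10|x].
  case: z => a b; rewrite !lecE /= => /andP[_ /andP[/eqP <- _]].
  by exists a.
by rewrite -(fmorph_root toC) => /c_N10; rewrite !lecE /= oppr0 eqxx.
Qed.
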